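(* For every finite word $w$ in $\{0,1,2\}$, writing $b_j=b_j^{(w)}$, the weights satisfy $$b_0^{(w0)}=\frac{9b_0}{13b_0+b_1+b_2},\quad b_1^{(w0)}=\frac{2b_0+2b_1-b_2}{13b_0+b_1+b_2},\quad b_2^{(w0)}=\frac{2b_0-b_1+2b_2}{13b_0+b_1+b_2},$$ $$b_0^{(w1)}=\frac{2b_0+2b_1-b_2}{b_0+13b_1+b_2},\quad b_1^{(w1)}=\frac{9b_1}{b_0+13b_1+b_2},\quad b_2^{(w1)}=\frac{-b_0+2b_1+2b_2}{b_0+13b_1+b_2},$$ $$b_0^{(w2)}=\frac{2b_0-b_1+2b_2}{b_0+b_1+13b_2},\quad b_1^{(w2)}=\frac{-b_0+2b_1+2b_2}{b_0+b_1+13b_2},\quad b_2^{(w2)}=\frac{9b_2}{b_0+b_1+13b_2}.$$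
   Context: Let $$M_0=\tfrac1{15}\begin{pmatrix}9&0&0\\2&2&-1\\2&-1&2\end{pmatrix},\quad M_1=\tfrac1{15}\begin{pmatrix}2&2&-1\\0&9&0\\-1&2&2\end{pmatrix},\quad M_2=\tfrac1{15}\begin{pmatrix}2&-1&2\\-1&2&2\\0&0&9\end{pmatrix}.$$ For a finite word $w=(w_1,\dots,w_m)$ in $\{0,1,2\}$ let $M_w=M_{w_1}M_{w_2}\cdots M_{w_m}$ (identity for the empty word), and, indexing columns by $0,1,2$, define $$b_j^{(w)}=\frac16+\frac12\cdot\frac{\text{sum of the entries of column } j\text{ of }M_w}{\text{sum of all entries of }M_w},\qquad j=0,1,2,$$ so that $b_0^{(w)}+b_1^{(w)}+b_2^{(w)}=1$. (These are the weights expressing the average of the Radon-Nikodym derivative of an energy measure of harmonic functions with respect to the Kusuoka measure over the cell $F_wSG$ of the Sierpinski gasket as a weighted average of its values at the three boundary vertices of the cell.) $wi$ denotes the word $w$ followed by the letter $i$. *)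

(* Defs.v *)
From mathcomp Require Import all_boot all_order all_algebra.

Set Implicit Arguments.
Unset Strict Implicit.
Unset Printing Implicit Defensive.

Import GRing.Theory.
Local Open Scope ring_scope.

(* Letters are elements of 'I_3; in ring scope 0, 1, 2 : 'I_3 have values
   0, 1, 2 (via the ring structure of Z/3 on 'I_3). *)
Definition word := seq 'I_3.

Definition mx3_of_rows (R : nzRingType) (rows : seq (seq R)) : 'M[R]_3 :=
  \matrix_(i < 3, j < 3) nth 0 (nth [::] rows i) j.

Definition cell_mx (R : realFieldType) (i : 'I_3) : 'M[R]_3 :=
  15^-1 *: mx3_of_rows
    match val i with
    | 0%N => [:: [:: 9;  0;  0];
                 [:: 2;  2; -1];
                 [:: 2; -1;  2]]
    | 1%N => [:: [:: 2;  2; -1];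
                 [:: 0;  9;  0];
                 [:: -1; 2;  2]]
    | _   => [:: [:: 2; -1;  2];
                 [:: -1; 2;  2];
                 [:: 0;  0;  9]]
    end.

(* The product follows the order of the letters: M_{w_1} M_{w_2} ... M_{w_m}. *)
Definition word_mx (R : realFieldType) (w : word) : 'M[R]_3 :=
  \prod_(i <- w) cell_mx R i.

Definition weight (R : realFieldType) (w : word) (j : 'I_3) : R :=
  6^-1 + 2^-1 * ((\sum_(k < 3) word_mx R w k j) /
                 (\sum_(k < 3) \sum_(l < 3) word_mx R w k l)).

(* Main.v *)
Require Import Defs.
From mathcomp Require Import all_boot all_order all_algebra.
From mathcomp Require Import ring lra.

(** Appending the letter [i] to [w] multiplies [M_w] on the right by [M_i], so
    the row vector [c] of column sums becomes [c *m M_i].  The total of the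
    entries of [M_w] is [s = c_0 + c_1 + c_2], hence [c_j / s = 2 b_j - 1/3]:
    the new weights are rational functions of the old ones.  The new total is
    [(6 c_i + 3 s) / 15 = s (12 b_i + 1) / 15], and [12 b_i + 1] is the stated
    denominator because [b_0 + b_1 + b_2 = 1].

    What needs an argument is that no total vanishes.  Each [M_i] is similar,
    up to the factor [1/15], to the symmetric square of a 2 x 2 matrix with
    eigenvalues 3 and 1, so it multiplies a quadratic form, the discriminant,
    by [9 / 15 ^ 2].  That form is the same for the three letters, and
    therefore symmetric: it is the second elementary symmetric polynomial
    [e2 c = c_0 c_1 + c_0 c_2 + c_1 c_2].  It has signature (1, 2), so that
    [e2 c > 0] and [s > 0] describe one half of an open cone; on that half
    [2 c_i + s > 0] ([half_cone_gt0]), which means that every letter preserves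
    it ([half_cone_step]).  The half cone contains the column sums [(1, 1, 1)]
    of the identity, hence those of every [M_w] ([colsum_half_cone]).

    The three letters play symmetric roles, so the update rule is proved for an
    arbitrary enumeration [i, j, k] of the alphabet, [i] being the new letter
    ([weight_rcons]). *)

Local Open Scope ring_scope.
Import Order.TTheory GRing.Theory Num.Theory.

Definition colsum (R : realFieldType) (w : word) (j : 'I_3) : R :=
  \sum_(k < 3) word_mx R w k j.

Lemma mem_letters (i j k l : 'I_3) : uniq [:: i; j; k] -> l \in [:: i; j; k].
Proof.
move=> ijk; rewrite (_ : _ =i 'I_3) //.
apply/subset_cardP; last exact: subset_predT.
by rewrite (card_uniqP ijk) card_ord.
Qed.

Lemma sum_letters (V : nmodType) (F : 'I_3 -> V) (i j k : 'I_3) :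
  uniq [:: i; j; k] -> \sum_l F l = F i + (F j + F k).
Proof.
move=> ijk; have enum_ijk : perm_eq (index_enum 'I_3) [:: i; j; k].
  apply: uniq_perm => // [|l]; first exact: index_enum_uniq.
  by rewrite mem_index_enum mem_letters.
by rewrite (perm_big _ enum_ijk) !big_cons big_nil /= addr0.
Qed.

(** [M_i] is invariant under the exchange of the two letters other than [i], so
    these two columns determine the third. *)
Lemma cell_mx_cols (R : realFieldType) (i j k : 'I_3) :
  uniq [:: i; j; k] ->
  ([/\ cell_mx R i i i = 9 / 15, cell_mx R i j i = 2 / 15
     & cell_mx R i k i = 2 / 15] *
   [/\ cell_mx R i i j = 0, cell_mx R i j j = 2 / 15
     & cell_mx R i k j = - 1 / 15])%type.
Proof.
rewrite /cell_mx /mx3_of_rows.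
case: i j k => [[|[|[|//]]] ?] [[|[|[|//]]] ?] [[|[|[|//]]] ?] //= _;
  by do 2 split; rewrite !mxE /=; field.
Qed.

Lemma colsum_rcons (R : realFieldType) (w : word) (i j k : 'I_3) :
  uniq [:: i; j; k] ->
  colsum R (rcons w i) i =
    (9 * colsum R w i + 2 * colsum R w j + 2 * colsum R w k) / 15 /\
  colsum R (rcons w i) j = (2 * colsum R w j - colsum R w k) / 15.
Proof.
move=> ijk.
have colsumM a b :
    colsum R (rcons w a) b = \sum_l colsum R w l * cell_mx R a l b.
  rewrite /colsum /word_mx -cats1 big_cat big_seq1 /=.
  under eq_bigr do rewrite mxE.
  by rewrite exchange_big; apply: eq_bigr => l _; rewrite mulr_suml.
rewrite !colsumM !(sum_letters _ _ _ _ _ ijk).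
have [[-> -> ->] [-> -> ->]] := cell_mx_cols R _ _ _ ijk.
by split; field.
Qed.

(** The set [e2 > 0], on which the form rescaled by every [M_i] is positive, has
    two components; the sign of the total picks one of them. *)
Definition half_cone (R : realFieldType) (x y z : R) : Prop :=
  0 < x + y + z /\ 0 < x * y + x * z + y * z.

(** With [t = y + z], [y * z <= t ^ 2 / 4] gives [0 < t * (x + t / 4)]; a
    negative [t] would make [x + t] negative as soon as [x + t / 4] is, so
    both factors are positive and [3 x + t > t / 4 > 0]. *)
Lemma half_cone_gt0 (R : realFieldType) (x y z : R) :
  half_cone R x y z -> 0 < 3 * x + y + z.
Proof.
case=> s_gt0 e2_gt0.
have prod_gt0 : 0 < (y + z) * (x + (y + z) / 4).
  suff : 0 <= (y - z) ^+ 2 by nra.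
  exact: sqr_ge0.
case: (ltrP 0 (y + z)) => [t_gt0|t_le0]; last by nra.
by move: prod_gt0; rewrite pmulr_rgt0 //; lra.
Qed.

Lemma half_cone_step (R : realFieldType) (x y z : R) :
  half_cone R x y z ->
  half_cone R ((9 * x + 2 * y + 2 * z) / 15) ((2 * y - z) / 15)
              ((2 * z - y) / 15).
Proof.
move=> xyz; have [_ e2_gt0] := xyz; split.
  by have := half_cone_gt0 _ _ _ _ xyz; lra.
rewrite [ltRHS](_ : _ = 9 / 15 ^+ 2 * (x * y + x * z + y * z)); last by field.
by rewrite pmulr_rgt0 // divr_gt0 // exprn_gt0.
Qed.

Lemma uniq_swap23 (i j k : 'I_3) : uniq [:: i; j; k] -> uniq [:: i; k; j].
Proof. by rewrite (@perm_uniq _ _ [:: i; k; j]) // perm_cons (perm_catC [:: j]). Qed.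

Lemma colsum_half_cone (R : realFieldType) (w : word) (i j k : 'I_3) :
  uniq [:: i; j; k] ->
  half_cone R (colsum R w i) (colsum R w j) (colsum R w k).
Proof.
elim/last_ind: w i j k => [|w l IHw] i j k ijk.
  have colsum0 a : colsum R [::] a = 1.
    rewrite /colsum /word_mx big_nil (bigD1 a) //= mxE eqxx big1 ?addr0 // => b.
    by rewrite mxE => /negPf ->.
  by rewrite !colsum0; split; lra.
(* The half cone is symmetric, so the last letter [l] may be put first. *)
have first a b : uniq [:: l; a; b] ->
    half_cone R (colsum R (rcons w l) l) (colsum R (rcons w l) a)
                (colsum R (rcons w l) b).
  move=> lab; have lba := uniq_swap23 _ _ _ lab.
  have [-> ->] := colsum_rcons R w _ _ _ lab.
  have [_ ->] := colsum_rcons R w _ _ _ lba.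
  exact/half_cone_step/IHw.
have := mem_letters _ _ _ l ijk.
rewrite !inE => /or3P[] /eqP l_eq; rewrite -{}l_eq in ijk *.
- exact: first.
- have [] := first i k; last by split; lra.
  by rewrite -(@perm_uniq _ [:: i; l; k]) // (perm_catCA [:: i] [:: l]).
- have [] := first i j; last by split; lra.
  by rewrite -(@perm_uniq _ [:: i; j; l]) // (perm_catC [:: i; j]).
Qed.

Lemma weightE (R : realFieldType) (w : word) (i j k l : 'I_3) :
  uniq [:: i; j; k] ->
  weight R w l =
    6^-1 + 2^-1 * (colsum R w l / (colsum R w i + colsum R w j + colsum R w k)).
Proof.
move=> ijk; rewrite /weight exchange_big.
by rewrite (sum_letters _ (colsum R w) _ _ _ ijk) addrA.
Qed.

Lemma weight_rcons (R : realFieldType) (w : word) (i j k : 'I_3) :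
  uniq [:: i; j; k] ->
  let bi := weight R w i in
  let bj := weight R w j in
  let bk := weight R w k in
  [/\ weight R (rcons w i) i = 9 * bi / (13 * bi + bj + bk),
      weight R (rcons w i) j = (2 * bi + 2 * bj - bk) / (13 * bi + bj + bk)
    & weight R (rcons w i) k = (2 * bi - bj + 2 * bk) / (13 * bi + bj + bk)].
Proof.
move=> ijk /=; have ikj := uniq_swap23 _ _ _ ijk.
rewrite !(weightE _ _ _ _ _ _ ijk).
have [-> ->] := colsum_rcons R w _ _ _ ijk.
have [_ ->] := colsum_rcons R w _ _ _ ikj.
have cone := colsum_half_cone R w _ _ _ ijk.
have := half_cone_gt0 _ _ _ _ cone; case: cone => + _.
move: (colsum R w i) (colsum R w j) (colsum R w k) => x y z s_gt0 s'_gt0.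
by split; field; apply/and3P; split; rewrite gt_eqF //; lra.
Qed.

Theorem theorem6p2 (R : realFieldType) (w : word) :
  let b0 := weight R w 0 in
  let b1 := weight R w 1 in
  let b2 := weight R w 2 in
  [/\ [/\ weight R (rcons w 0) 0 = 9 * b0 / (13 * b0 + b1 + b2),
          weight R (rcons w 0) 1 = (2 * b0 + 2 * b1 - b2) / (13 * b0 + b1 + b2)
        & weight R (rcons w 0) 2 = (2 * b0 - b1 + 2 * b2) / (13 * b0 + b1 + b2)],
      [/\ weight R (rcons w 1) 0 = (2 * b0 + 2 * b1 - b2) / (b0 + 13 * b1 + b2),
          weight R (rcons w 1) 1 = 9 * b1 / (b0 + 13 * b1 + b2)
        & weight R (rcons w 1) 2 = (- b0 + 2 * b1 + 2 * b2) / (b0 + 13 * b1 + b2)]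
    & [/\ weight R (rcons w 2) 0 = (2 * b0 - b1 + 2 * b2) / (b0 + b1 + 13 * b2),
          weight R (rcons w 2) 1 = (- b0 + 2 * b1 + 2 * b2) / (b0 + b1 + 13 * b2)
        & weight R (rcons w 2) 2 = 9 * b2 / (b0 + b1 + 13 * b2)]].
Proof.
have [//|r00 r01 r02] := weight_rcons R w 0 1 2.
have [//|r11 r10 r12] := weight_rcons R w 1 0 2.
have [//|r22 r20 r21] := weight_rcons R w 2 0 1.
move=> b0 b1 b2.
split; split=> //; rewrite ?(r10, r11, r12, r20, r21, r22) -/b0 -/b1 -/b2.
all: congr (_ / _); ring.
Qed.
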